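(* Let $T$ be a training set, $F$ a feature set, $\mathcal{L}$ a learning algorithm and $c^*:X\to Y$ the target classification function. If there is a prediction error $x\in X$ for $T$, $F$, $\mathcal{L}$ (a training set prediction error or a generalization error), then there is a mislabeling error, a representation error, a learner error, or a boundary error. Here, if $x$ is a training set prediction error, the error types are taken relative to $T$; if $x$ is a generalization error, representation and learner errors are taken relative to the augmented training set $T'=T\cup\{(x,c^*(x))\}$, and boundary error is as defined in the context.
   Context: $X$ is a set of objects, $Y$ a set of labels; a classification function is a map $X\to Y$, and $\mathcal{C}$ is the set of all of them. The target classification function $c^*\in\mathcal{C}$ is fixed. A feature is a function $X\to\mathbb{R}$; a fixed set $R$ of (teachable) features is given, and a feature set is a finite subset $F=\{f_1,\dots,f_p\}$ of $R$, which maps $x\in X$ to $F(x)=(f_1(x),\dots,f_p(x))\in\mathbb{R}^p$, where $p=|F|$. A training set is a finite set $T\subset X\times Y$; write $T_X=\{x\mid (x,y)\in T\}$. A $d$-dimensional learning algorithm $\ell_d$ takes a $d$-dimensional feature set $F$ and a training set $T$ and outputs a function $\mathbb{R}^d\to Y$. A vector learning algorithm is a family $\ell=\{\ell_0,\ell_1,\dots\}$ of $d$-dimensional learning algorithms, one for each $d$. The associated learning algorithm is $\mathcal{L}(F,T)=\ell_{|F|}(F,T)\circ F\in\mathcal{C}$. $\mathcal{C}(F,\mathcal{L})$ is the set of $c\in\mathcal{C}$ for which there is a training set $S$ with $\mathcal{L}(F,S)=c$. A prediction error for $T,F,\mathcal{L}$ is an $x\in X$ with $\mathcal{L}(F,T)(x)\neq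 c^*(x)$. It is a training set prediction error if $x\in T_X$ and a generalization error if $x\in X\setminus T_X$. Error types: - Mislabeling error: a labeled example $(z,y)\in T$ with $y\ne c^*(z)$. - Representation error relative to a training set $S$: for every $c\in\mathcal{C}(F,\mathcal{L})$ there is $(z,y)\in S$ with $c(z)\neq c^*(z)$. - Learner error relative to a training set $S$: there is $c\in\mathcal{C}(F,\mathcal{L})$ with $c(z)=c^*(z)$ for all $(z,y)\in S$, but every $c\in\mathcal{C}(F,\mathcal{L})$ with this property satisfies $\mathcal{L}(F,S)\neq c$. - Boundary error (for a generalization error $x$): with $c=\mathcal{L}(F,T)$, $T'=T\cup\{(x,c^*(x))\}$ and $c'=\mathcal{L}(F,T')$, the function $c'$ correctly predicts the augmented training set, i.e. $c'(z)=c^*(z)$ for all $(z,y)\in T'$; in particular $c(x)\neq c'(x)=c^*(x)$. *)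

(* Defs.v *)
From HB Require Import structures.
From mathcomp Require Import all_boot all_order all_algebra finmap.
From mathcomp Require Import boolp classical_sets reals.

Set Implicit Arguments.
Unset Strict Implicit.
Unset Printing Implicit Defensive.

Local Open Scope ring_scope.
Local Open Scope classical_set_scope.

(* Objects and labels form choiceTypes so that training sets
   can be finite sets [{fset X * Y}]; classically every type is a choiceType. *)

Section Features.
Context (R : realType) (X : choiceType) (teachable : set (X -> R)).

Record featureSet := FeatureSet {
  features :> {fset (X -> R)};
  features_teachable : [set` features] `<=` teachable }.

Definition featureSet_of_dim (d : nat) := {F : featureSet | #|` F|%fset = d}.

(* F(x) = (f_1(x), ..., f_p(x)), where f_1, ..., f_p is the duplicate-free
   enumeration carried by the finite set F. *)
Definition feature_vector (F : featureSet) (x : X) : 'rV[R]_(#|` F|%fset) :=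
  \row_(i < #|` F|%fset) nth (fun=> 0) F i x.

End Features.

Section Learners.
Context (R : realType) (X Y : choiceType) (teachable : set (X -> R)).

Definition dim_learner (d : nat) :=
  featureSet_of_dim teachable d -> {fset X * Y} -> 'rV[R]_d -> Y.

Definition vector_learner := forall d : nat, dim_learner d.

Definition learner := featureSet teachable -> {fset X * Y} -> X -> Y.

Definition associated_learner (ell : vector_learner) : learner :=
  fun F T => ell #|` F|%fset (exist _ F erefl) T \o feature_vector F.

End Learners.

Section Errors.
Context (R : realType) (X Y : choiceType) (teachable : set (X -> R)).
Implicit Types (F : featureSet teachable) (L : learner Y teachable).
Implicit Types (c cstar : X -> Y) (T S : {fset X * Y}) (x : X).

Definition classifiers F L : set (X -> Y) :=
  [set c | exists S, L F S = c].

Definition objects T : {fset X} := [fset e.1 | e in T]%fset.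

Definition prediction_error cstar T F L x : Prop := L F T x <> cstar x.

Definition training_error cstar T F L x : Prop :=
  prediction_error cstar T F L x /\ x \in objects T.

Definition generalization_error cstar T F L x : Prop :=
  prediction_error cstar T F L x /\ x \notin objects T.

Definition augment cstar T x : {fset X * Y} := (T `|` [fset (x, cstar x)])%fset.

(* Correctness is judged against the target, not against the labels in S. *)
Definition correct_on cstar S c : Prop :=
  forall z y, (z, y) \in S -> c z = cstar z.

Definition mislabeling_error cstar T : Prop :=
  exists z y, (z, y) \in T /\ y <> cstar z.

Definition representation_error cstar S F L : Prop :=
  forall c, classifiers F L c -> exists z y, (z, y) \in S /\ c z <> cstar z.

Definition learner_error cstar S F L : Prop :=
  (exists c, classifiers F L c /\ correct_on cstar S c) /\
  (forall c, classifiers F L c -> correct_on cstar S c -> L F S <> c).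

Definition boundary_error cstar T F L x : Prop :=
  generalization_error cstar T F L x /\
  correct_on cstar (augment cstar T x) (L F (augment cstar T x)).

End Errors.

(* Main.v *)
Require Import Defs.
From mathcomp Require Import all_boot all_algebra finmap.
From mathcomp Require Import boolp classical_sets reals.

(** For any training set [S], excluding representation and learner errors forces [L F S] to agree
    with [cstar] on the objects of [S]. With [S = T] this contradicts an error at an object of [T];
    with [S = T'] it is the condition that makes a generalization error a boundary error. *)

(* If some classifier is correct on [S] but the learner's output is not, the
   output differs from every classifier correct on [S]: a learner error. *)
Lemma representation_or_learner_error_or_correct (R : realType)
    (X Y : choiceType) (teachable : set (X -> R)) (cstar : X -> Y)
    (S : {fset X * Y}) (F : featureSet teachable) (L : learner Y teachable) :
  representation_error cstar S F L \/ learner_error cstar S F L \/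
  correct_on cstar S (L F S).
Proof.
have [correctS|wrongS] := pselect (correct_on cstar S (L F S)).
  by right; right.
have [exc|noc] :=
  pselect (exists c, classifiers F L c /\ correct_on cstar S c).
  by right; left; split=> // c _ correct_c LFS; apply: wrongS; rewrite LFS.
left=> c Cc; apply: contrapT => no_err; apply: noc; exists c; split=> // z y Szy.
by apply: contrapT => czN; apply: no_err; exists z, y.
Qed.

Theorem proposition2 (R : realType) (X Y : choiceType)
    (teachable : set (X -> R)) (cstar : X -> Y)
    (T : {fset X * Y}) (F : featureSet teachable)
    (ell : vector_learner Y teachable) (x : X) :
  let L := associated_learner ell in
  let T' := augment cstar T x in
  prediction_error cstar T F L x ->
  (training_error cstar T F L x /\
     (mislabeling_error cstar T \/
      representation_error cstar T F L \/
      learner_error cstar T F L))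
  \/
  (generalization_error cstar T F L x /\
     (mislabeling_error cstar T \/
      representation_error cstar T' F L \/
      learner_error cstar T' F L \/
      boundary_error cstar T F L x)).
Proof.
move=> L T' err.
have [xT|xNT] := boolP (x \in objects T).
  left; split; first by split.
  have [rep|[lrn|correctT]] :=
    representation_or_learner_error_or_correct _ _ _ _ cstar T F L.
  - by right; left.
  - by right; right.
  (* The label [y] is arbitrary: [correct_on] compares with [cstar z], so [correctT] refutes [err]
     at [x = z] even if [y] is wrong. *)
  - case/imfsetP: xT => -[z y] /= Tzy xz.
    by case: err; rewrite xz; apply: correctT Tzy.
right; split; first by split.
right; have [rep|[lrn|correctT']] :=
  representation_or_learner_error_or_correct _ _ _ _ cstar T' F L.
- by left.
- by right; left.
- by right; right; split.
Qed.
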